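(* Let $K$ be a field of characteristic zero, let $n \ge 1$, let $S = K[x_1,\dots,x_n]$, $\mathfrak{m} = (x_1,\dots,x_n)$, $R = S/\mathfrak{m}^2$ and $V = \mathfrak{m}/\mathfrak{m}^2 \subseteq R$. A $K$-linear map $P : R \to R$ is a Rota--Baxter operator of weight zero if and only if $\operatorname{Im}(P) \subseteq V$ and $P^2 = 0$.
   Context: A $K$-linear map $P : R \to R$ is a Rota--Baxter operator of weight zero if $P(x)P(y) = P\bigl(xP(y) + P(x)y\bigr)$ for all $x,y \in R$. As a $K$-vector space $R = K \oplus V$, where $K$ is identified with the scalar multiples of the unit $1$, and $V$ is the $n$-dimensional space with basis the images $\bar x_1,\dots,\bar x_n$ of $x_1,\dots,x_n$. Multiplication is $(a+u)(b+v) = ab + av + bu$ for $a,b\in K$, $u,v\in V$, so $V\cdot V = 0$. $P^2$ denotes the composition $P\circ P$. *)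

(* Defs.v *)
From HB Require Import structures.
From mathcomp Require Import all_boot all_algebra.
From mathcomp Require Import ring_quotient boolp.
From mathcomp.multinomials Require Import mpoly.

Set Implicit Arguments.
Unset Strict Implicit.
Unset Printing Implicit Defensive.

Import GRing.Theory.

Local Open Scope ring_scope.
Local Open Scope quotient_scope.

Section Ideals.
Variable A : comNzRingType.

(* Ideals are boolean predicates, as [{ideal_quot _}] requires; membership is
   made boolean with the classical [`[< _ >]]. *)
Definition ideal_gen (I : finType) (g : I -> A) : {pred A} :=
  fun p => `[< exists c : I -> A, p = \sum_i c i * g i >].

Definition ideal_mul (I J : {pred A}) : {pred A} :=
  fun p => `[< exists2 s : seq (A * A),
                 all (fun ab => (ab.1 \in I) && (ab.2 \in J)) s
               & p = \sum_(ab <- s) ab.1 * ab.2 >].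

Lemma ideal_genMl (I : finType) (g : I -> A) a p :
  p \in ideal_gen g -> a * p \in ideal_gen g.
Proof.
move=> /asboolP[c ->]; apply/asboolP; exists (fun i => a * c i).
by rewrite mulr_sumr; apply: eq_bigr => i _; rewrite mulrA.
Qed.

Lemma ideal_mul_lin (I J : {pred A}) :
  (forall a p, p \in I -> a * p \in I) ->
  forall a, {in ideal_mul I J &, forall u v, a * u + v \in ideal_mul I J}.
Proof.
move=> hI a u v /asboolP[s hs ->] /asboolP[t ht ->]; apply/asboolP.
exists ([seq (a * ab.1, ab.2) | ab <- s] ++ t).
  rewrite all_cat ht andbT all_map; apply: sub_all hs => -[x y] /= /andP[xI ->].
  by rewrite hI.
rewrite big_cat big_map mulr_sumr; congr (_ + _).
by apply: eq_bigr => ab _; rewrite mulrA.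
Qed.

Lemma ideal_mul0 (I J : {pred A}) : 0 \in ideal_mul I J.
Proof. by apply/asboolP; exists [::]; rewrite // big_nil. Qed.

End Ideals.

Section Quotient.
Variables (K : fieldType) (n : nat).

Definition max_ideal : {pred {mpoly K[n]}} :=
  ideal_gen (fun i : 'I_n => 'X_i : {mpoly K[n]}).

Definition max_ideal2 : {pred {mpoly K[n]}} := ideal_mul max_ideal max_ideal.

Lemma max_ideal_eval0 p : p \in max_ideal -> p.@[fun=> 0] = 0.
Proof.
move=> /asboolP[c ->]; rewrite raddf_sum big1 // => i _.
by rewrite /= mevalM mevalXU mulr0.
Qed.

Lemma max_ideal2_closed : idealr_closed max_ideal2.
Proof.
split; first exact: ideal_mul0.
- apply/asboolP => -[s hs] /(congr1 (meval (fun=> 0))) /eqP.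
  rewrite rmorph1 raddf_sum big_seq big1 ?oner_eq0 // => ab /(allP hs)/andP[h _].
  by rewrite /= mevalM max_ideal_eval0 ?mul0r.
- exact/ideal_mul_lin/ideal_genMl.
Qed.

HB.instance Definition _ := isIdealr.Build _ max_ideal2 max_ideal2_closed.

(* K[x_1, ..., x_n] / m^2 *)
Definition trunc_mpoly : Type := {ideal_quot max_ideal2}.

HB.instance Definition _ := GRing.ComNzRing.on trunc_mpoly.

Definition trunc_pi (p : {mpoly K[n]}) : trunc_mpoly :=
  \pi_({ideal_quot max_ideal2}) p.

Definition trunc_scale (a : K) (x : trunc_mpoly) : trunc_mpoly :=
  trunc_pi a%:MP * x.

Lemma trunc_pi_is_zmod_morphism : zmod_morphism trunc_pi.
Proof. exact: (rmorphB (\pi_({ideal_quot max_ideal2}))). Qed.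

Lemma trunc_pi_is_monoid_morphism : monoid_morphism trunc_pi.
Proof.
by split; [exact: (rmorph1 (\pi_({ideal_quot max_ideal2})))
          |exact: (rmorphM (\pi_({ideal_quot max_ideal2})))].
Qed.

HB.instance Definition _ := GRing.isZmodMorphism.Build _ _ trunc_pi
  trunc_pi_is_zmod_morphism.
HB.instance Definition _ := GRing.isMonoidMorphism.Build _ _ trunc_pi
  trunc_pi_is_monoid_morphism.

Lemma trunc_scaleA a b x :
  trunc_scale a (trunc_scale b x) = trunc_scale (a * b) x.
Proof. by rewrite /trunc_scale mulrA -rmorphM -mpolyCM. Qed.

Lemma trunc_scale1 : left_id 1 trunc_scale.
Proof. by move=> x; rewrite /trunc_scale mpolyC1 rmorph1 mul1r. Qed.

Lemma trunc_scaleDr : right_distributive trunc_scale +%R.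
Proof. by move=> a x y; rewrite /trunc_scale mulrDr. Qed.

Lemma trunc_scaleDl x : {morph trunc_scale^~ x : a b / a + b}.
Proof. by move=> a b; rewrite /trunc_scale mpolyCD rmorphD mulrDl. Qed.

HB.instance Definition _ := GRing.Zmodule_isLmodule.Build K trunc_mpoly
  trunc_scaleA trunc_scale1 trunc_scaleDr trunc_scaleDl.

Lemma trunc_scaleAl a (x y : trunc_mpoly) : a *: (x * y) = a *: x * y.
Proof. exact: mulrA. Qed.

HB.instance Definition _ := GRing.Lmodule_isLalgebra.Build K trunc_mpoly
  trunc_scaleAl.

Lemma trunc_scaleAr a (x y : trunc_mpoly) : a *: (x * y) = x * (a *: y).
Proof. exact: mulrCA. Qed.

HB.instance Definition _ := GRing.Lalgebra_isAlgebra.Build K trunc_mpoly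
  trunc_scaleAr.

Lemma trunc_pi_is_scalable : scalable trunc_pi.
Proof. by move=> a p; rewrite -mul_mpolyC rmorphM. Qed.

HB.instance Definition _ := GRing.isScalable.Build K _ _ _ trunc_pi
  trunc_pi_is_scalable.

(* m / m^2, the image of m in the quotient *)
Definition trunc_max : {pred trunc_mpoly} :=
  fun x => `[< exists2 p, p \in max_ideal & x = trunc_pi p >].

End Quotient.

Definition rota_baxter0 (K : fieldType) (A : algType K) (P : {linear A -> A}) :=
  forall x y : A, P x * P y = P (x * P y + P x * y).

(* Main.v *)
From HB Require Import structures.
Require Import Defs.
From mathcomp Require Import all_boot all_algebra.
From mathcomp Require Import ring_quotient boolp.
From mathcomp.multinomials Require Import mpoly.

(** The argument uses only that [R] carries an augmentation [eps : R -> K],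
    an algebra morphism, whose kernel [V] satisfies [V V = 0]; then
    [x v = eps x *: v] for [v] in [V].

    If [P] maps into [V] and [P^2 = 0], both sides of the Rota-Baxter identity
    vanish: [P x P y] lies in [V V], and
    [x (P y) + (P x) y = eps x *: P y + eps y *: P x] is killed by [P].

    Conversely, write [f = eps \o P].  For [u] in [V] the element [u (P u)] is
    [f u *: u], so applying [eps] to the identity at [(u, u)] gives
    [f u ^ 2 = 2 f u ^ 2], hence [f u = 0].  Knowing that [f] vanishes on [V],
    the identity at [(1, 1)] gives in the same way [f 1 ^ 2 = 2 f 1 ^ 2].  Thus
    [f = 0], that is, [P] maps into [V].  The identity at [(x, 1)] now reads
    [0 = eps x *: P (P 1) + P (P x)]; at [x = 1] this is [2 P (P 1) = 0],
    which, as 2 is invertible, kills the first summand for every [x].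

    For [K[x_1, ..., x_n] / m^2] the augmentation is evaluation at the origin.
    Its kernel is [m / m^2] because a polynomial without constant term is a
    combination of the variables. *)

Set Implicit Arguments.
Unset Strict Implicit.
Unset Printing Implicit Defensive.

Import GRing.Theory.

Local Open Scope ring_scope.
Local Open Scope quotient_scope.

Section SquareZeroAugmentation.
Variables (K : fieldType) (A : algType K) (eps : {lrmorphism A -> K^o}).
Hypothesis ker_sq0 : forall u v : A, eps u = 0 -> eps v = 0 -> u * v = 0.

Lemma augm_scalar (a : K) : eps a%:A = a.
Proof. by rewrite linearZ /= rmorph1; apply: mulr1. Qed.

Lemma augm_sub (x : A) : eps (x - (eps x : K)%:A) = 0.
Proof. by rewrite raddfB /= augm_scalar subrr. Qed.

Lemma mul_augm_ker (x v : A) : eps v = 0 -> x * v = (eps x : K) *: v.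
Proof.
move=> v0; have := ker_sq0 (augm_sub x) v0.
by rewrite mulrBl mulr_algl => /eqP; rewrite subr_eq0 => /eqP.
Qed.

Lemma mul_ker_augm (x v : A) : eps v = 0 -> v * x = (eps x : K) *: v.
Proof.
move=> v0; have := ker_sq0 v0 (augm_sub x).
by rewrite mulrBr mulr_algr => /eqP; rewrite subr_eq0 => /eqP.
Qed.

Lemma sqr_double_eq0 (a : K) : a * a = a * a + a * a -> a = 0.
Proof.
by rewrite -[LHS]addr0 => /addrI/esym/eqP; rewrite mulf_eq0 orbb => /eqP.
Qed.

Variable P : {linear A -> A}.

(** Applying [eps] to the identity at [(u, u)] doubles a square, because
    [u * P u] and [P u * u] are both [eps (P u) *: u]. *)
Lemma rota_baxter0_augm_ker : rota_baxter0 P ->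
  forall u, eps u = 0 -> eps (P u) = 0.
Proof.
move=> RB u u0; have := congr1 eps (RB u u).
rewrite [u * _]mul_ker_augm // [_ * u]mul_augm_ker // !raddfD /= !linearZ /=.
by rewrite rmorphM => /sqr_double_eq0.
Qed.

Lemma rota_baxter0_augm : rota_baxter0 P -> forall x, eps (P x) = 0.
Proof.
move=> RB; have Pker := rota_baxter0_augm_ker RB.
(* [eps \o P] is determined by its value at 1, since it vanishes on [V] *)
have fE x : eps (P x) = eps x * eps (P 1).
  have := Pker _ (augm_sub x).
  by rewrite !raddfB /= linearZ /= linearZ => /eqP; rewrite subr_eq0 => /eqP.
have f1 : eps (P 1) = 0.
  have := congr1 eps (RB 1 1).
  rewrite mul1r mulr1 raddfD /= raddfD /= [eps (P (P 1))]fE rmorphM.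
  exact: sqr_double_eq0.
by move=> x; rewrite fE f1 mulr0.
Qed.

(** [P x * P 1 = 0] since both factors lie in [V], so [P (P x)] is the multiple
    [- eps x] of [P (P 1)]; [x = 1] then forces [2 P (P 1) = 0]. *)
Lemma rota_baxter0_sqr0 : (2%:R != 0 :> K) -> rota_baxter0 P ->
  forall x, P (P x) = 0.
Proof.
move=> nz2 RB; have f0 := rota_baxter0_augm RB.
have E x : (eps x : K) *: P (P 1) + P (P x) = 0.
  have := RB x 1; rewrite ker_sq0 // mulr1 mul_augm_ker //.
  by rewrite raddfD /= linearZ => <-.
have PP1 : P (P 1) = 0.
  have /eqP := E 1; rewrite rmorph1 scale1r -mulr2n -scaler_nat scaler_eq0.
  by rewrite (negPf nz2) => /eqP.
by move=> x; have := E x; rewrite PP1 scaler0 add0r.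
Qed.

Lemma sqr0_rota_baxter0 : (forall x, eps (P x) = 0) ->
  (forall x, P (P x) = 0) -> rota_baxter0 P.
Proof.
move=> f0 PP x y; rewrite ker_sq0 // mul_augm_ker // mul_ker_augm //.
by rewrite raddfD /= !linearZ /= !PP !scaler0 addr0.
Qed.

Theorem rota_baxter0_square_zeroP : (2%:R != 0 :> K) ->
  rota_baxter0 P <-> (forall x, eps (P x) = 0) /\ (forall x, P (P x) = 0).
Proof.
move=> nz2; split=> [RB|[f0 PP]]; last exact: sqr0_rota_baxter0.
by split; [exact: rota_baxter0_augm|exact: rota_baxter0_sqr0].
Qed.

End SquareZeroAugmentation.

Lemma ideal_gen_sum (A : comNzRingType) (I : finType) (g : I -> A)
    (T : Type) (s : seq T) (F : T -> A) :
  (forall t, F t \in ideal_gen g) -> \sum_(t <- s) F t \in ideal_gen g.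
Proof.
move=> Fg; apply: (big_ind (fun p => p \in ideal_gen g)) => //.
  by apply/asboolP; exists (fun=> 0); rewrite big1 // => i _; rewrite mul0r.
move=> _ _ /asboolP[c ->] /asboolP[d ->]; apply/asboolP.
exists (fun i => c i + d i).
by rewrite -big_split; apply: eq_bigr => i _; rewrite mulrDl.
Qed.

Section TruncatedPolynomials.
Variables (K : fieldType) (n : nat).
Local Notation eval0 := (meval (fun=> 0 : K) : {mpoly K[n]} -> K).

Lemma mpolyX_max_ideal (m : 'X_{1..n}) :
  m != 0%MM -> 'X_[m] \in @max_ideal K n.
Proof.
move=> m0; have [i mi] : exists i, m i != 0%N.
  apply/existsP; apply: contraR m0 => /existsPn mE.
  by apply/eqP/mnmP => i; rewrite mnm0E; apply/eqP; rewrite -[_ == _]negbK mE.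
have -> : 'X_[m] = 'X_[m - U_(i)] * 'X_i :> {mpoly K[n]}.
  rewrite -mpolyXD submK //; apply/mnm_lepP => j; rewrite mnm1E.
  by case: eqP => // <-; rewrite lt0n.
apply: ideal_genMl; apply/asboolP; exists (fun j => (j == i)%:R).
rewrite (bigD1 i) //= eqxx mul1r big1 ?addr0 // => j /negPf ->.
by rewrite mul0r.
Qed.

(** Subtracting the constant term monomial by monomial leaves only monomials
    that some variable divides. *)
Lemma sub_eval0_max_ideal (p : {mpoly K[n]}) :
  p - (eval0 p)%:MP \in @max_ideal K n.
Proof.
have -> : p - (eval0 p)%:MP
    = \sum_(m <- msupp p) (p@_m)%:MP * ('X_[m] - (eval0 'X_[m])%:MP).
  have -> : eval0 p = \sum_(m <- msupp p) p@_m * eval0 'X_[m].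
    rewrite {1}(mpolyE p) (raddf_sum (meval _)).
    by apply: eq_bigr => m _; rewrite /= mevalZ.
  rewrite {1}(mpolyE p) (raddf_sum (@mpolyC n K)) -sumrB.
  by apply: eq_bigr => m _; rewrite /= mpolyCM -mul_mpolyC mulrBr.
apply: ideal_gen_sum => m; apply: ideal_genMl.
have [->|m0] := eqVneq m 0%MM.
  rewrite mpolyX0 rmorph1 mpolyC1 subrr.
  by apply/asboolP; exists (fun=> 0); rewrite big1 // => i _; rewrite mul0r.
by have mX := mpolyX_max_ideal m0; rewrite max_ideal_eval0 // mpolyC0 subr0.
Qed.

Lemma max_idealE (p : {mpoly K[n]}) : (p \in @max_ideal K n) = (eval0 p == 0).
Proof.
apply/idP/eqP => [/max_ideal_eval0 //|p0].
by have := sub_eval0_max_ideal p; rewrite p0 mpolyC0 subr0.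
Qed.

Lemma max_ideal2_eval0 (p : {mpoly K[n]}) : p \in @max_ideal2 K n -> eval0 p = 0.
Proof.
move=> /asboolP[s hs ->]; rewrite raddf_sum big_seq big1 // => ab.
by move=> /(allP hs)/andP[h _]; rewrite /= mevalM max_ideal_eval0 ?mul0r.
Qed.

(** Evaluation at the origin, read on a chosen representative;
    [trunc_aug_pi] shows that the choice does not matter.  The codomain is
    [K^o] so that the map can be an algebra morphism. *)
Definition trunc_aug (x : trunc_mpoly K n) : K^o :=
  eval0 (repr (x : {ideal_quot @max_ideal2 K n})).

Lemma trunc_piP (x : trunc_mpoly K n) : exists p, x = trunc_pi p.
Proof.
by exists (repr (x : {ideal_quot @max_ideal2 K n})); rewrite /trunc_pi reprK.
Qed.

Lemma trunc_aug_pi p : trunc_aug (trunc_pi p) = eval0 p.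
Proof.
apply/eqP; rewrite -subr_eq0 -mevalB; apply/eqP/max_ideal2_eval0.
by rewrite Quotient.idealrBE reprK.
Qed.

Lemma trunc_aug_is_zmod_morphism : zmod_morphism trunc_aug.
Proof.
move=> x y; have [p ->] := trunc_piP x; have [q ->] := trunc_piP y.
by rewrite -raddfB !trunc_aug_pi raddfB.
Qed.

Lemma trunc_aug_is_monoid_morphism : monoid_morphism trunc_aug.
Proof.
split=> [|x y]; first by rewrite -(rmorph1 (@trunc_pi K n)) trunc_aug_pi rmorph1.
have [p ->] := trunc_piP x; have [q ->] := trunc_piP y.
by rewrite -rmorphM !trunc_aug_pi rmorphM.
Qed.

Lemma trunc_aug_is_scalable : scalable trunc_aug.
Proof.
by move=> a x; have [p ->] := trunc_piP x; rewrite -linearZ !trunc_aug_pi mevalZ.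
Qed.

HB.instance Definition _ := GRing.isZmodMorphism.Build _ _ trunc_aug
  trunc_aug_is_zmod_morphism.
HB.instance Definition _ := GRing.isMonoidMorphism.Build _ _ trunc_aug
  trunc_aug_is_monoid_morphism.
HB.instance Definition _ := GRing.isScalable.Build K _ _ _ trunc_aug
  trunc_aug_is_scalable.

Lemma trunc_maxE x : (x \in @trunc_max K n) = (trunc_aug x == 0).
Proof.
apply/asboolP/eqP => [[p pm ->]|]; first by rewrite trunc_aug_pi max_ideal_eval0.
have [p ->] := trunc_piP x; rewrite trunc_aug_pi => /eqP.
by rewrite -max_idealE; exists p.
Qed.

Lemma trunc_aug_ker_sq0 (u v : trunc_mpoly K n) :
  trunc_aug u = 0 -> trunc_aug v = 0 -> u * v = 0.
Proof.
have [p ->] := trunc_piP u; have [q ->] := trunc_piP v.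
rewrite !trunc_aug_pi => /eqP p0 /eqP q0.
rewrite -rmorphM -(rmorph0 (@trunc_pi K n)).
apply/eqP; rewrite /trunc_pi -Quotient.idealrBE subr0; apply/asboolP.
by exists [:: (p, q)]; rewrite ?big_seq1 //= !max_idealE p0 q0.
Qed.

End TruncatedPolynomials.

Theorem theorem3p4 (K : fieldType) (charK0 : [pchar K] =i pred0)
    (n : nat) (n_gt0 : (1 <= n)%N)
    (P : {linear trunc_mpoly K n -> trunc_mpoly K n}) :
  rota_baxter0 P <->
  (forall x, P x \in @trunc_max K n) /\ (forall x, P (P x) = 0).
Proof.
have nz2 : 2%:R != 0 :> K by have := charK0 2%N; rewrite !inE /= => ->.
have imP : (forall x, P x \in @trunc_max K n)
    <-> (forall x, trunc_aug (P x) = 0).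
  by split=> h x; apply/eqP; have := h x; rewrite trunc_maxE => /eqP ->.
rewrite imP.
exact: (rota_baxter0_square_zeroP (@trunc_aug_ker_sq0 K n) P nz2).
Qed.
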